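(* Let $q$ be a complex number with $|q|<1$. Then the following three identities hold: \begin{align*} &\sum_{n=0}^\infty \frac{(-1)^n q^{2n^2}(q^2;q^4)_{n}^2(q;q^2)_{2n}}{(q^4;q^4)_{n}^2(q^4;q^4)_{2n}} \biggl([8n+1]+[4n+1]\frac{q^{4n+1}}{1+q^{4n+2}}\biggr) =\frac{(1+q)(q^2;q^4)_{\infty}(q^6;q^4)_{\infty}}{(q^4;q^4)_{\infty}^2}, \\[4pt] &\sum_{n=0}^\infty \frac{(-1)^n q^{2n^2}(q^2;q^4)_{n}(q^2;q^4)_{2n}(q;q^2)_{3n}}{(q^4;q^4)_{n}^2(q^4;q^4)_{3n}(q;q^2)_n} \\ &\qquad\times\biggl([10n+1]+\frac{q^{6n+1}[4n+2][6n+1]}{[12n+4]}+\frac{q^{6n+3}[6n+1][6n+3][8n+2](1+q^{2n+1})}{[12n+4][12n+8]}\biggr) \\ &\qquad=\frac{(1+q)(q^2;q^4)_{\infty}(q^6;q^4)_{\infty}}{(q^4;q^4)_{\infty}^2}, \\[4pt] &\sum_{n=0}^\infty \frac{q^{4n^2}(q;q^2)_{2n}^2}{(q^4;q^4)_{n}^2(q^4;q^4)_{2n}} \biggl([8n+1]-q^{8n+3}\frac{[4n+1]^2}{[8n+4]}\biggr) =\frac{(q^3;q^4)_\infty (q^5;q^4)_\infty}{(q^4;q^4)_\infty^2}. \end{align*}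
   Context: For $|q|<1$ and a complex number $a$, $(a;q)_\infty=\prod_{j=0}^\infty(1-aq^j)$ and, for a nonnegative integer $n$, $(a;q)_n=\prod_{j=0}^{n-1}(1-aq^j)$ (with $(a;q)_0=1$); these are used with $q$ replaced by $q^2$ or $q^4$ as indicated, e.g. $(a;q^4)_n=\prod_{j=0}^{n-1}(1-aq^{4j})$. The $q$-number is $[m]=[m]_q=(1-q^m)/(1-q)$. *)

(* Defs.v *)
From Stdlib Require Import Reals.
From Coquelicot Require Import Coquelicot.
Open Scope C_scope.

Fixpoint qpoch (a q : C) (n : nat) : C :=
  match n with
  | O => 1
  | S m => qpoch a q m * (1 - a * q ^ m)
  end.

(* [iota] picks the limit of the partial products, which is unique when it
   exists (it does when |q| < 1); see [iota_filterlim_locally]. *)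
Definition qpoch_inf (a q : C) : C :=
  @iota C_CompleteNormedModule
    (fun l : C => filterlim (qpoch a q) eventually (locally l)).

Definition qnum (q : C) (m : nat) : C := (1 - q ^ m) / (1 - q).

(* Main.v *)
Require Import Defs.
From Stdlib Require Import Reals Lra Lia.
From Coquelicot Require Import Coquelicot.
Open Scope C_scope.

(** All three series are staircase sums of q-WZ pairs. If
    [G n (k+1) - G n k = F (n+1) k - F n k], the sum of [G] along horizontal and
    of [F] along vertical steps of a lattice path depends only on its endpoints.

    With [p = q^4] and [a = b = c = q], let [G n k] be the n-th term of the
    very-well-poised 6phi5 series in base [p] with parameters
    [a, b/p^k, c, d], divided by its sum. The diagonal staircase
    [G n n + F (n+1) n] is [1 - q] times the first summand for [d = q^2] and
    times the third one for [d = oo]; moving the path to the axis [k = 0] changes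
    the sum by terms that vanish in the limit. The series at [k = 0] is evaluated
    by the WZ pair for [a -> a p^m] with [b, c, d] fixed: as [m -> oo] only the
    term [n = 0] survives.

    The first summand is also the diagonal staircase of a WZ pair of quadratic
    type with [G n k = (1 - q^(6n+2k+1)) T n k], and the staircase along
    [k = 2n] of that same pair is the second summand. *)

(** * Complex limits through real limits of moduli *)

(** A real null sequence keeps the squeeze and limit rules for real sequences available;
    [Cconv_filterlim] leads back to the filters behind [is_series] and [qpoch_inf]. *)
Definition Cconv (u : nat -> C) (l : C) : Prop :=
  is_lim_seq (fun n => Cmod (u n - l)) 0%R.

Lemma Cconv_of_le (u : nat -> C) (l : C) (e : nat -> R) :
  (forall n, (Cmod (u n - l) <= e n)%R) -> is_lim_seq e 0%R -> Cconv u l.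
Proof.
  intros H He.
  apply (is_lim_seq_le_le (fun _ => 0%R) _ e).
  - intros n; split; [apply Cmod_ge_0 | apply H].
  - apply is_lim_seq_const.
  - exact He.
Qed.

Lemma Cconv_ext (u v : nat -> C) (l : C) :
  (forall n, u n = v n) -> Cconv u l -> Cconv v l.
Proof.
  intros H; apply is_lim_seq_ext; intros n; now rewrite H.
Qed.

Lemma Cconv_const (c : C) : Cconv (fun _ => c) c.
Proof.
  apply Cconv_of_le with (fun _ => 0%R); [|apply is_lim_seq_const].
  intros n; replace (c - c) with (RtoC 0) by ring; rewrite Cmod_0; lra.
Qed.

Lemma Cconv_plus (u v : nat -> C) (l m : C) :
  Cconv u l -> Cconv v m -> Cconv (fun n => u n + v n) (l + m).
Proof.
  intros Hu Hv.
  apply Cconv_of_le with (fun n => (Cmod (u n - l) + Cmod (v n - m))%R).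
  - intros n; replace (u n + v n - (l + m)) with ((u n - l) + (v n - m)) by ring.
    apply Cmod_triangle.
  - replace 0%R with (0 + 0)%R by ring; now apply is_lim_seq_plus'.
Qed.

Lemma Cconv_mult (u v : nat -> C) (l m : C) :
  Cconv u l -> Cconv v m -> Cconv (fun n => u n * v n) (l * m).
Proof.
  intros Hu Hv.
  apply Cconv_of_le with
    (fun n => (Cmod (u n - l) * Cmod (v n - m) + Cmod (u n - l) * Cmod m
               + Cmod l * Cmod (v n - m))%R).
  - intros n.
    replace (u n * v n - l * m)
      with ((u n - l) * (v n - m) + (u n - l) * m + l * (v n - m)) by ring.
    rewrite <- !Cmod_mult.
    eapply Rle_trans; [apply Cmod_triangle|].
    apply Rplus_le_compat_r, Cmod_triangle.
  - replace 0%R with (0 * 0 + 0 * Cmod m + Cmod l * 0)%R by ring.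
    apply is_lim_seq_plus'; [apply is_lim_seq_plus'|];
      apply is_lim_seq_mult'; auto using is_lim_seq_const.
Qed.

Lemma Cconv_inv (u : nat -> C) (l : C) (M : R) :
  (forall n, u n <> 0) -> (forall n, (Cmod (/ u n) <= M)%R) -> l <> 0 ->
  Cconv u l -> Cconv (fun n => / u n) (/ l).
Proof.
  intros Hu HM Hl H.
  apply Cconv_of_le with (fun n => (Cmod (u n - l) * (M * Cmod (/ l)))%R).
  - intros n.
    replace (/ u n - / l) with (- ((u n - l) * (/ u n * / l)))
      by (field; auto).
    rewrite Cmod_opp, !Cmod_mult.
    apply Rmult_le_compat_l; [apply Cmod_ge_0|].
    apply Rmult_le_compat_r; [apply Cmod_ge_0 | apply HM].
  - replace 0%R with (0 * (M * Cmod (/ l)))%R by ring.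
    apply is_lim_seq_mult'; auto using is_lim_seq_const.
Qed.

Lemma Cconv_filterlim (u : nat -> C) (l : C) :
  filterlim u eventually (@locally C_NormedModule l) <-> Cconv u l.
Proof.
  rewrite filterlim_locally_ball_norm.
  unfold Cconv; rewrite <- is_lim_seq_spec; simpl.
  split; intros H eps; specialize (H eps); revert H;
    apply filter_imp; intros n Hn.
  - rewrite Rminus_0_r, Rabs_pos_eq by apply Cmod_ge_0; exact Hn.
  - rewrite Rminus_0_r, Rabs_pos_eq in Hn by apply Cmod_ge_0; exact Hn.
Qed.

Lemma is_series_of_telescope (a V : nat -> C) (l : C) :
  V O = 0 -> (forall n, V (S n) - V n = a n) -> Cconv V l ->
  @is_series C_AbsRing C_NormedModule a l.
Proof.
  intros V0 HV Hl.
  apply (proj2 (Cconv_filterlim _ _)).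
  (* The n-th partial sum of a series includes term n, hence the shift by one. *)
  apply Cconv_ext with (fun n => V (S n)).
  - induction n as [|n IH].
    + rewrite sum_O, <- HV, V0; ring.
    + rewrite sum_Sn, <- IH, <- HV. unfold plus; simpl; ring.
  - unfold Cconv in *; now apply is_lim_seq_incr_1 in Hl.
Qed.

(** * Bounds for finite q-shifted factorials *)

(** Homogeneous form x^n (y/x; p)_n of the q-shifted factorial, meaningful also at x = 0. *)
Fixpoint hpoch (x y p : C) (n : nat) : C :=
  match n with
  | O => 1
  | S m => hpoch x y p m * (x - y * p ^ m)
  end.

Lemma hpoch_qpoch (a p : C) (n : nat) : hpoch 1 a p n = qpoch a p n.
Proof. induction n as [|n IH]; simpl; [|rewrite IH]; reflexivity. Qed.

(** For m >= 1 the factor p x - y p^m is p times the factor of index m - 1 of [hpoch x y p]. This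
    relates [hpoch (p ^ k)] at k and k + 1. *)
Lemma hpoch_scale (x y p : C) (n : nat) :
  hpoch (p * x) y p (S n) = (p * x - y) * p ^ n * hpoch x y p n.
Proof.
  induction n as [|n IH].
  - simpl; ring.
  - change (hpoch (p * x) y p (S (S n)))
      with (hpoch (p * x) y p (S n) * (p * x - y * p ^ S n)).
    rewrite IH; simpl; ring.
Qed.

(** Since 1 + t <= exp t, the product of the factors 1 + c r^j is at most exp of c times a geometric
    sum. *)
Lemma growth_bounded (u : nat -> R) (c r : R) :
  (0 <= c)%R -> (0 <= r < 1)%R -> (u O <= 1)%R ->
  (forall n, (0 <= u n)%R) ->
  (forall n, (u (S n) <= u n * (1 + c * r ^ n))%R) ->
  forall n, (u n <= exp (c * (1 / (1 - r))))%R.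
Proof.
  intros Hc Hr H0 Hu HS.
  assert (H : forall n, (u n <= exp (c * ((1 - r ^ n) / (1 - r))))%R).
  { induction n as [|n IH].
    - replace (c * ((1 - r ^ 0) / (1 - r)))%R with 0%R by (simpl; field; lra).
      rewrite exp_0; exact H0.
    - replace (c * ((1 - r ^ S n) / (1 - r)))%R
        with (c * ((1 - r ^ n) / (1 - r)) + c * r ^ n)%R by (simpl; field; lra).
      rewrite exp_plus.
      eapply Rle_trans; [apply HS|].
      apply Rmult_le_compat; [apply Hu | | exact IH | apply exp_ineq1_le].
      assert (0 <= r ^ n)%R by (apply pow_le; lra). nra. }
  intros n. eapply Rle_trans; [apply H|].
  assert (L : (c * ((1 - r ^ n) / (1 - r)) <= c * (1 / (1 - r)))%R).
  { apply Rmult_le_compat_l; [assumption|].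
    apply Rmult_le_compat_r; [apply Rlt_le, Rinv_0_lt_compat; lra|].
    assert (0 <= r ^ n)%R by (apply pow_le; lra). lra. }
  destruct L as [L|L]; [left; now apply exp_increasing | rewrite L; lra].
Qed.

Lemma hpoch_bounded (x y p : C) :
  (Cmod p < 1)%R -> (Cmod x <= 1)%R ->
  exists M, forall n, (Cmod (hpoch x y p n) <= M)%R.
Proof.
  intros Hp Hx. eexists.
  apply (growth_bounded _ (Cmod y) (Cmod p)).
  - apply Cmod_ge_0.
  - split; [apply Cmod_ge_0 | exact Hp].
  - simpl; rewrite Cmod_1; lra.
  - intros n; apply Cmod_ge_0.
  - intros n. simpl hpoch. rewrite Cmod_mult.
    apply Rmult_le_compat_l; [apply Cmod_ge_0|].
    eapply Rle_trans; [apply Cmod_triangle|].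
    rewrite Cmod_opp, Cmod_mult, Cmod_pow. lra.
Qed.

Lemma qpoch_bounded (a p : C) : (Cmod p < 1)%R ->
  exists M, forall n, (Cmod (qpoch a p n) <= M)%R.
Proof.
  intros Hp.
  destruct (hpoch_bounded 1 a p Hp) as [M HM]; [rewrite Cmod_1; lra|].
  exists M; intros n; rewrite <- hpoch_qpoch; apply HM.
Qed.

Lemma Cmod_pow_le_1 (z : C) (n : nat) : (Cmod z <= 1)%R -> (Cmod (z ^ n) <= 1)%R.
Proof.
  intros H; rewrite Cmod_pow, <- (pow1 n).
  apply pow_incr; split; [apply Cmod_ge_0 | exact H].
Qed.

Lemma Cmod_mul_pow_lt_1 (a p : C) (n : nat) :
  (Cmod a < 1)%R -> (Cmod p < 1)%R -> (Cmod (a * p ^ n) < 1)%R.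
Proof.
  intros Ha Hp; rewrite Cmod_mult.
  assert (H1 := Cmod_pow_le_1 p n (Rlt_le _ _ Hp)).
  assert (H2 := Cmod_ge_0 (p ^ n)).
  assert (H3 := Cmod_ge_0 a). nra.
Qed.

Lemma Cone_minus_neq_0 (z : C) : (Cmod z < 1)%R -> 1 - z <> 0.
Proof.
  intros H E. replace z with (RtoC 1) in H.
  - rewrite Cmod_1 in H; lra.
  - replace (RtoC 1) with (1 - z + z) by ring. rewrite E; ring.
Qed.

Lemma qpoch_neq_0 (a p : C) (n : nat) :
  (Cmod a < 1)%R -> (Cmod p < 1)%R -> qpoch a p n <> 0.
Proof.
  intros Ha Hp; induction n as [|n IH]; simpl.
  - intro E; apply (f_equal fst) in E; simpl in E; lra.
  - apply Cmult_neq_0; [exact IH|].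
    now apply Cone_minus_neq_0, Cmod_mul_pow_lt_1.
Qed.

Lemma Cmod_one_minus_ge (z : C) : (1 - Cmod z <= Cmod (1 - z))%R.
Proof.
  assert (H := Cmod_triangle (1 - z) z).
  replace (1 - z + z) with (RtoC 1) in H by ring.
  rewrite Cmod_1 in H; lra.
Qed.

(** With b = |a| and r = |p|^n, each factor satisfies 1/(1 - b r) = 1 + b r/(1 - b r) <= 1 + r b/(1
    - b), so [growth_bounded] applies with c = b/(1 - b). *)
Lemma qpoch_inv_bounded (a p : C) : (Cmod a < 1)%R -> (Cmod p < 1)%R ->
  exists M, forall n, (Cmod (/ qpoch a p n) <= M)%R.
Proof.
  intros Ha Hp. eexists.
  assert (Ha0 := Cmod_ge_0 a).
  apply (growth_bounded _ (Cmod a / (1 - Cmod a)) (Cmod p)).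
  - apply Rmult_le_pos; [exact Ha0 | apply Rlt_le, Rinv_0_lt_compat; lra].
  - split; [apply Cmod_ge_0 | exact Hp].
  - simpl. replace (/ 1)%C with (RtoC 1) by field. rewrite Cmod_1; lra.
  - intros n; apply Cmod_ge_0.
  - intros n. simpl qpoch.
    assert (Hx := Cmod_mul_pow_lt_1 a p n Ha Hp).
    assert (Hn := Cone_minus_neq_0 _ Hx).
    replace (/ (qpoch a p n * (1 - a * p ^ n)))
      with (/ qpoch a p n * / (1 - a * p ^ n))
      by (field; auto using qpoch_neq_0).
    rewrite Cmod_mult.
    apply Rmult_le_compat_l; [apply Cmod_ge_0|].
    rewrite Cmod_inv by exact Hn.
    assert (Hg := Cmod_one_minus_ge (a * p ^ n)).
    assert (Hrn := Cmod_pow_le_1 p n (Rlt_le _ _ Hp)).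
    rewrite Cmod_mult, Cmod_pow in Hg, Hx. rewrite Cmod_pow in Hrn.
    assert (Hr0 : (0 <= Cmod p ^ n)%R) by apply pow_le, Cmod_ge_0.
    set (r := (Cmod p ^ n)%R) in *. set (b := Cmod a) in *.
    apply Rle_trans with (/ (1 - b * r))%R.
    { apply Rinv_le_contravar; lra. }
    replace (/ (1 - b * r))%R with (1 + b * r * / (1 - b * r))%R by (field; lra).
    apply Rplus_le_compat_l.
    replace (b / (1 - b) * r)%R with (b * r * / (1 - b))%R by (field; lra).
    apply Rmult_le_compat_l; [nra|].
    apply Rinv_le_contravar; nra.
Qed.

(** * Infinite products *)

(** Consecutive partial products differ by -(a;p)_n a p^n, which is geometrically small because
    (a;p)_n is bounded. *)
Lemma qpoch_conv (a p : C) : (Cmod p < 1)%R -> exists l, Cconv (qpoch a p) l.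
Proof.
  intros Hp.
  destruct (qpoch_bounded a p Hp) as [M HM].
  set (d := fun n => qpoch a p (S n) - qpoch a p n).
  assert (E : @ex_series C_AbsRing C_CompleteNormedModule d).
  { apply ex_series_le with (fun n => (M * Cmod a * Cmod p ^ n)%R).
    - intros n. change (Cmod (d n) <= M * Cmod a * Cmod p ^ n)%R.
      unfold d. simpl qpoch.
      replace (qpoch a p n * (1 - a * p ^ n) - qpoch a p n)
        with (- (qpoch a p n * (a * p ^ n))) by ring.
      rewrite Cmod_opp, !Cmod_mult, Cmod_pow, Rmult_assoc.
      apply Rmult_le_compat_r; [|apply HM].
      apply Rmult_le_pos; [apply Cmod_ge_0 | apply pow_le, Cmod_ge_0].
    - apply (ex_series_scal (V := R_NormedModule)), ex_series_geom.
      rewrite Rabs_pos_eq; [exact Hp | apply Cmod_ge_0]. }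
  destruct E as [l Hl].
  (* The differences telescope from (a;p)_0 = 1. *)
  exists (l + 1).
  apply (proj1 (Cconv_filterlim _ _)) in Hl.
  assert (H : Cconv (fun n => qpoch a p (S n)) (l + 1)).
  { apply Cconv_ext with (fun n => sum_n d n + 1).
    - induction n as [|n IH].
      + rewrite sum_O; unfold d; simpl; ring.
      + rewrite sum_Sn.
        replace (qpoch a p (S (S n))) with (d (S n) + qpoch a p (S n))
          by (unfold d; ring).
        rewrite <- IH. unfold plus; simpl; ring.
    - apply Cconv_plus; [exact Hl | apply Cconv_const]. }
  unfold Cconv in *. now apply is_lim_seq_incr_1.
Qed.

Lemma qpoch_inf_conv (a p : C) : (Cmod p < 1)%R ->
  Cconv (qpoch a p) (qpoch_inf a p).
Proof.
  intros Hp. destruct (qpoch_conv a p Hp) as [l Hl].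
  replace (qpoch_inf a p) with l; [exact Hl|].
  symmetry.
  apply (@iota_filterlim_locally C_AbsRing C_CompleteNormedModule nat eventually _
           (qpoch a p) l).
  now apply Cconv_filterlim.
Qed.

(** The reciprocals of the partial products stay below some M; a zero limit would give 1 <= M *
    0. *)
Lemma qpoch_inf_neq_0 (a p : C) : (Cmod a < 1)%R -> (Cmod p < 1)%R ->
  qpoch_inf a p <> 0.
Proof.
  intros Ha Hp E.
  destruct (qpoch_inv_bounded a p Ha Hp) as [M HM].
  assert (H := qpoch_inf_conv a p Hp). rewrite E in H.
  assert (K : Rbar_le 1%R (M * 0)%R).
  { apply (is_lim_seq_le (fun _ => 1%R) (fun n => (M * Cmod (qpoch a p n - 0))%R)).
    - intros n.
      replace (qpoch a p n - 0) with (qpoch a p n) by ring.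
      assert (Hq := qpoch_neq_0 a p n Ha Hp).
      replace 1%R with (Cmod (/ qpoch a p n) * Cmod (qpoch a p n))%R.
      + apply Rmult_le_compat_r; [apply Cmod_ge_0 | apply HM].
      + rewrite <- Cmod_mult, Cinv_l by exact Hq. apply Cmod_1.
    - apply is_lim_seq_const.
    - apply is_lim_seq_mult'; [apply is_lim_seq_const | exact H]. }
  simpl in K; lra.
Qed.

Lemma qpoch_inf_inv_conv (a p : C) : (Cmod a < 1)%R -> (Cmod p < 1)%R ->
  Cconv (fun n => / qpoch a p n) (/ qpoch_inf a p).
Proof.
  intros Ha Hp. destruct (qpoch_inv_bounded a p Ha Hp) as [M HM].
  apply Cconv_inv with M; auto using qpoch_neq_0, qpoch_inf_neq_0, qpoch_inf_conv.
Qed.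

Lemma qpoch_inf_shift (a p : C) : (Cmod p < 1)%R ->
  qpoch_inf a p = (1 - a) * qpoch_inf (a * p) p.
Proof.
  intros Hp.
  assert (E : forall n, qpoch a p (S n) = (1 - a) * qpoch (a * p) p n).
  { induction n as [|n IH]; [simpl; ring|].
    change (qpoch a p (S (S n))) with (qpoch a p (S n) * (1 - a * p ^ S n)).
    rewrite IH; simpl; ring. }
  assert (H : Cconv (fun n => qpoch a p (S n)) ((1 - a) * qpoch_inf (a * p) p)).
  { apply Cconv_ext with (fun n => (1 - a) * qpoch (a * p) p n).
    - intros n; now rewrite E.
    - apply Cconv_mult; [apply Cconv_const | now apply qpoch_inf_conv]. }
  assert (H' : Cconv (qpoch a p) ((1 - a) * qpoch_inf (a * p) p))
    by (unfold Cconv in *; now apply is_lim_seq_incr_1).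
  apply Cconv_filterlim in H'.
  now apply (@iota_filterlim_locally C_AbsRing C_CompleteNormedModule nat eventually _
           (qpoch a p)).
Qed.

(** * The three WZ pairs *)

(* The 6phi5 term with [a = c = q], [b = q / p^k], [d = y / x], without the factor
   [1 - a p^(2n)] and divided by the k-dependent part of the 6phi5 sum. The
   argument [a p / (b c d)] forces [p = q s y]; storing [d] as a quotient makes
   [d = oo] ([x = 0]) admissible, and [hpoch] absorbs the negative powers of [p]. *)
Definition bshiftT (q x y s p : C) (n k : nat) : C :=
  qpoch q p n ^ 2 * hpoch (p ^ k) q p n * hpoch x y p n * s ^ n
  / (qpoch p p n ^ 2 * qpoch p p (n + k) * qpoch (q * (q * s * x)) p n)
  * (qpoch (s * y) p k * qpoch (q * s * x) p k / qpoch (s * x) p k).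

Definition bshiftG (q x y s p : C) (n k : nat) : C :=
  (1 - q * (p ^ n) ^ 2) * bshiftT q x y s p n k.

(** WZ certificate, taken as the quotient of F at n + 1 by [bshiftT] at n. The value 0 of [bshiftF]
    at n = 0 is the boundary value for which the WZ equation holds there too. *)
Definition bshiftR (q x y s p : C) (n k : nat) : C :=
  s * p ^ k * (1 - q * p ^ n) ^ 2 * (x - y * p ^ n)
  / ((1 - p * (p ^ n * p ^ k)) * (1 - s * x * p ^ k)).

Definition bshiftF (q x y s p : C) (n k : nat) : C :=
  match n with
  | O => 0
  | S m => bshiftT q x y s p m k * bshiftR q x y s p m k
  end.

Ltac nonzero :=
  auto using qpoch_neq_0, Cone_minus_neq_0, Cmod_mul_pow_lt_1.

(** After the common q-shifted factorials are taken out, both sides are rational functions of p^n,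
    p^k and the parameters, and [field] decides the identity. *)
Lemma bshift_WZ (q x y s p : C) (n k : nat) :
  p = q * s * y ->
  (Cmod p < 1)%R -> (Cmod (s * x) < 1)%R -> (Cmod (q * (q * s * x)) < 1)%R ->
  bshiftG q x y s p n (S k) - bshiftG q x y s p n k
  = bshiftF q x y s p (S n) k - bshiftF q x y s p n k.
Proof.
  intros Ep Hp Hsx Ht.
  assert (D1 : forall m, 1 - p * p ^ m <> 0) by (intros; nonzero).
  assert (D2 : forall m, 1 - s * x * p ^ m <> 0) by (intros; nonzero).
  assert (D3 : forall m, 1 - q * (q * s * x) * p ^ m <> 0) by (intros; nonzero).
  assert (P1 : forall m, qpoch p p m <> 0) by (intros; nonzero).
  assert (P2 : forall m, qpoch (s * x) p m <> 0) by (intros; nonzero).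
  assert (P3 : forall m, qpoch (q * (q * s * x)) p m <> 0) by (intros; nonzero).
  destruct n as [|n].
  - unfold bshiftF, bshiftG, bshiftT, bshiftR. simpl.
    generalize (P1 k) (D1 k) (P2 k) (D2 k).
    generalize (qpoch p p k) (qpoch (s * x) p k) (qpoch (s * y) p k)
       (qpoch (q * s * x) p k) (p ^ k).
    intros d1 d2 e1 e2 B; subst p; intros; field; repeat split; auto.
  - unfold bshiftF, bshiftG, bshiftT, bshiftR.
    rewrite Nat.add_succ_r; cbn [Nat.add].
    (* Here the argument p^k and the length of [hpoch] both rise by one; this brings all terms back
       to [hpoch (p ^ k) q p n]. *)
    rewrite (Cpow_S p k), hpoch_scale.
    cbn [qpoch hpoch Cpow].
    generalize (P1 n) (P1 (n+k)%nat) (P2 k) (P3 n) (D1 n) (D1 (n+k)%nat) (D2 k) (D3 n)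
      (D1 (S n+k)%nat).
    rewrite !Cpow_add_r. cbn [Cpow].
    generalize (qpoch p p n) (qpoch p p (n+k)%nat) (qpoch (s * x) p k)
       (qpoch (q * (q * s * x)) p n) (qpoch (s * y) p k)
       (qpoch (q * s * x) p k) (p ^ k) (p ^ n) (s ^ n) (qpoch q p n)
       (hpoch (p^k) q p n) (hpoch x y p n).
    intros d1 d2 d3 d4 e1 e2 B A a1 a2 a3 a4. intros.
    (* The constraint p = q s y enters only after every power and factorial in base p has become an
       atom. *)
    subst p.
    field.
    repeat split; auto.
Qed.

(* The same with [a = q p^m], [b = c = q], [d = y / x]. *)
Definition ashiftT (q x y s p : C) (n m : nat) : C :=
  qpoch q p (n + m) * qpoch q p n ^ 2 * hpoch x y p n * s ^ n * (p ^ m) ^ n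
  / (qpoch p p n * qpoch p p (n + m) ^ 2 * qpoch (q * (q * s * x)) p (n + m))
  * (qpoch (s * y) p m * qpoch (q * s * x) p m ^ 2 / qpoch (s * x) p m).

Definition ashiftG (q x y s p : C) (n m : nat) : C :=
  (1 - q * (p ^ n) ^ 2 * p ^ m) * ashiftT q x y s p n m.

Definition ashiftR (q x y s p : C) (n m : nat) : C :=
  s * p ^ m * (1 - q * p ^ n) ^ 2 * (x - y * p ^ n) * (1 - q * (p ^ n * p ^ m))
  * (1 - s * y * (q * (q * s * x)) * (p ^ n * (p ^ m) ^ 2))
  / ((1 - s * x * p ^ m) * (1 - p * (p ^ n * p ^ m)) ^ 2
     * (1 - q * (q * s * x) * (p ^ n * p ^ m))).

Definition ashiftF (q x y s p : C) (n m : nat) : C :=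
  match n with
  | O => 0
  | S l => ashiftT q x y s p l m * ashiftR q x y s p l m
  end.

Lemma ashift_WZ (q x y s p : C) (n m : nat) :
  p = q * s * y ->
  (Cmod p < 1)%R -> (Cmod (s * x) < 1)%R -> (Cmod (q * (q * s * x)) < 1)%R ->
  ashiftG q x y s p n (S m) - ashiftG q x y s p n m
  = ashiftF q x y s p (S n) m - ashiftF q x y s p n m.
Proof.
  intros Ep Hp Hsx Ht.
  assert (D1 : forall l, 1 - p * p ^ l <> 0) by (intros; nonzero).
  assert (D2 : forall l, 1 - s * x * p ^ l <> 0) by (intros; nonzero).
  assert (D3 : forall l, 1 - q * (q * s * x) * p ^ l <> 0) by (intros; nonzero).
  assert (P1 : forall l, qpoch p p l <> 0) by (intros; nonzero).
  assert (P2 : forall l, qpoch (s * x) p l <> 0) by (intros; nonzero).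
  assert (P3 : forall l, qpoch (q * (q * s * x)) p l <> 0) by (intros; nonzero).
  destruct n as [|n].
  - unfold ashiftF, ashiftG, ashiftT, ashiftR. cbn [qpoch hpoch Cpow Nat.add].
    generalize (P1 m) (D1 m) (P2 m) (D2 m) (P3 m) (D3 m).
    generalize (qpoch p p m) (qpoch (s * x) p m) (qpoch (s * y) p m)
       (qpoch (q * s * x) p m) (qpoch (q * (q * s * x)) p m) (qpoch q p m) (p ^ m).
    intros d1 d2 e1 e2 d3 a1 B; subst p; intros; field; repeat split; auto.
  - unfold ashiftF, ashiftG, ashiftT, ashiftR.
    rewrite Nat.add_succ_r; cbn [Nat.add].
    rewrite (Cpow_S p m), (Cpow_mult_l p (p ^ m)).
    cbn [qpoch hpoch Cpow].
    generalize (P1 n) (P1 (n+m)%nat) (P2 m) (P3 (n+m)%nat) (D1 n) (D1 (n+m)%nat)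
      (D2 m) (D3 (n + m)%nat) (D1 (S n+m)%nat) (D3 (S n + m)%nat).
    rewrite !Cpow_add_r. cbn [Cpow].
    generalize (qpoch p p n) (qpoch p p (n+m)%nat) (qpoch (s * x) p m)
       (qpoch (q * (q * s * x)) p (n+m)%nat) (qpoch (s * y) p m)
       (qpoch (q * s * x) p m) ((p ^ m) ^ n) (p ^ m) (p ^ n) (s ^ n) (qpoch q p n)
       (qpoch q p (n + m)%nat) (hpoch x y p n).
    intros d1 d2 d3 d4 e1 e2 BA B A a1 a2 a3 a4. intros.
    subst p.
    field.
    repeat split; auto.
Qed.

(* [quadT q n j], [quadG q n j] and [quadF q n j] stand for [T n (n+j)], [G n (n+j)] and
   [F (n+1) (n+j)]; only the region [k >= n] is needed. *)
Definition quadT (q : C) (n j : nat) : C :=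
  (- (1)) ^ n * q ^ (2 * n ^ 2)
  * qpoch (q ^ 2) (q ^ 4) n * qpoch (q ^ 2) (q ^ 4) (n + j)
  * qpoch q (q ^ 2) (n + (n + j))
  / (qpoch (q ^ 4) (q ^ 4) n ^ 2 * qpoch (q ^ 4) (q ^ 4) (n + (n + j))
     * qpoch q (q ^ 2) j).

Definition quadG (q : C) (n j : nat) : C :=
  (1 - q * (q ^ n) ^ 8 * (q ^ j) ^ 2) * quadT q n j.

Definition quadF (q : C) (n j : nat) : C :=
  quadT q n j
  * (q * (q ^ n) ^ 4 * (q ^ j) ^ 2 * (1 - q ^ 2 * (q ^ n) ^ 4)
     * (1 - q * ((q ^ n) ^ 4 * (q ^ j) ^ 2))
     / (1 - q ^ 4 * ((q ^ n) ^ 8 * (q ^ j) ^ 4))).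

Lemma Cmod_pow_lt_1 (q : C) (n : nat) : (Cmod q < 1)%R -> (Cmod (q ^ S n) < 1)%R.
Proof. intros H; rewrite Cpow_S; now apply Cmod_mul_pow_lt_1. Qed.

Lemma Cpow_pow_comm (q : C) (m n : nat) : (q ^ m) ^ n = (q ^ n) ^ m.
Proof. now rewrite <- !Cpow_mult_r, Nat.mul_comm. Qed.

Lemma Cpow_double_square_S (q : C) (n : nat) :
  q ^ (2 * S n ^ 2) = q ^ (2 * n ^ 2) * (q ^ n) ^ 4 * q ^ 2.
Proof.
  rewrite <- Cpow_mult_r, <- !Cpow_add_r. f_equal. simpl; ring.
Qed.

(** In unshifted indices this is the WZ equation at (n+1, n+1+j): [quadF q (S n) j] is F (n+2)
    (n+1+j) and [quadF q n (S j)] is F (n+1) (n+1+j). *)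
Lemma quad_WZ (q : C) (n j : nat) : (Cmod q < 1)%R ->
  quadG q (S n) (S j) - quadG q (S n) j = quadF q (S n) j - quadF q n (S j).
Proof.
  intros Hq.
  assert (H2 := Cmod_pow_lt_1 q 1 Hq). assert (H4 := Cmod_pow_lt_1 q 3 Hq).
  assert (D1 : forall l, 1 - q ^ 4 * (q ^ 4) ^ l <> 0) by (intros; nonzero).
  assert (D2 : forall l, 1 - q * (q ^ 2) ^ l <> 0) by (intros; nonzero).
  assert (P1 : forall l, qpoch (q ^ 4) (q ^ 4) l <> 0) by (intros; nonzero).
  assert (P2 : forall l, qpoch q (q ^ 2) l <> 0) by (intros; nonzero).
  unfold quadF, quadG, quadT.
  rewrite !Cpow_double_square_S.
  rewrite !Nat.add_succ_r; cbn [Nat.add]. rewrite !Nat.add_succ_r.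
  cbn [qpoch].
  generalize (P1 n) (P1 (n+(n+j))%nat) (P2 j) (D1 n) (D2 j)
    (D1 (n+(n+j))%nat) (D1 (S (n+(n+j)))%nat) (D1 (S (S (n+(n+j))))%nat).
  (* The modulus bounds [H2] and [H4] disappear here. Below, [H2], [H4], [H5], [H6] are the
     nonvanishing of 1 - q^4 (q^4)^l for l = n, 2n+j, 2n+j+1, 2n+j+2. *)
  clear.
  generalize (qpoch (q ^ 4) (q ^ 4) n) (qpoch (q ^ 4) (q ^ 4) (n + (n + j)))
    (qpoch (q ^ 2) (q ^ 4) n) (qpoch (q ^ 2) (q ^ 4) (n + j))
    (qpoch q (q ^ 2) j) (qpoch q (q ^ 2) (n + (n + j))) (q ^ (2 * n ^ 2)).
  intros d1 d2 a1 a2 d3 a3 a4.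
  rewrite !(Cpow_pow_comm q 4), !(Cpow_pow_comm q 2), !(Cpow_S q (_ + _)),
    !(Cpow_S q (S (_ + _))), !(Cpow_S q (_ + _)), !(Cpow_S q n), !(Cpow_S q j),
    !(Cpow_S (- (1)) n), !Cpow_add_r.
  generalize (q ^ n) (q ^ j) ((- (1)) ^ n).
  intros A B a5. intros.
  field.
  repeat split; try assumption;
    intro Z; 
    solve [apply H2; rewrite <- Z; ring | apply H4; rewrite <- Z; ring
          | apply H5; rewrite <- Z; ring | apply H6; rewrite <- Z; ring].
Qed.

(** * Finite sums and summation along lattice paths *)

(** The upper end is excluded, unlike in [sum_n], so that n counts the steps of a path segment. *)
Fixpoint csum (f : nat -> C) (n : nat) : C :=
  match n with
  | O => 0
  | S m => csum f m + f m
  end.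

Lemma csum_bound (f : nat -> C) (B : R) (n : nat) :
  (forall k, (k < n)%nat -> (Cmod (f k) <= B)%R) ->
  (Cmod (csum f n) <= INR n * B)%R.
Proof.
  induction n as [|n IH]; intros H.
  - simpl; rewrite Cmod_0; lra.
  - rewrite S_INR; cbn [csum].
    eapply Rle_trans; [apply Cmod_triangle|].
    assert (H1 := H n (Nat.lt_succ_diag_r n)).
    assert (H2 := IH (fun k Hk => H k (Nat.lt_lt_succ_r _ _ Hk))). lra.
Qed.

Lemma csum_telescope (f : nat -> C) (n : nat) :
  csum (fun k => f (S k) - f k) n = f n - f O.
Proof. induction n as [|n IH]; simpl; [ring | rewrite IH; ring]. Qed.

Lemma csum_ext (f g : nat -> C) (n : nat) :
  (forall k, f k = g k) -> csum f n = csum g n.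
Proof. intros H; induction n as [|n IH]; simpl; [|rewrite IH, H]; reflexivity. Qed.

Lemma csum_minus (f g : nat -> C) (n : nat) :
  csum (fun k => f k - g k) n = csum f n - csum g n.
Proof. induction n as [|n IH]; simpl; [ring | rewrite IH; ring]. Qed.

Lemma csum_shift (f : nat -> C) (n : nat) :
  csum f (S n) = f O + csum (fun k => f (S k)) n.
Proof.
  induction n as [|n IH]; [simpl; ring|].
  cbn [csum] in *; rewrite IH; ring.
Qed.

(** Put w^2 = (1 + r)/2, which exceeds r and is positive even for r = 0. Bernoulli's inequality for
    (1/w)^n bounds n w^n by 1/(1/w - 1), so n r^n is at most a constant times w^n. *)
Lemma is_lim_seq_INR_pow (r : R) : (0 <= r < 1)%R ->
  is_lim_seq (fun n => (INR n * r ^ n)%R) 0%R.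
Proof.
  intros Hr.
  set (t := ((1 + r) / 2)%R). set (w := sqrt t).
  assert (Ht : (0 < t < 1)%R) by (unfold t; lra).
  assert (Hw : (0 < w < 1)%R).
  { unfold w; split; [apply sqrt_lt_R0; lra|].
    rewrite <- sqrt_1; apply sqrt_lt_1; lra. }
  assert (Eww : (w * w = t)%R) by (apply sqrt_sqrt; lra).
  assert (Hi : (0 < / w - 1)%R).
  { assert (1 < / w)%R by (rewrite <- Rinv_1; apply Rinv_lt_contravar; lra). lra. }
  apply (is_lim_seq_le_le (fun _ => 0%R) _ (fun n => (/ (/ w - 1) * w ^ n)%R)).
  - intros n.
    assert (Hn := pos_INR n).
    assert (0 <= r ^ n <= t ^ n)%R
      by (split; [apply pow_le; lra | apply pow_incr; unfold t; lra]).
    split; [nra|].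
    apply Rle_trans with (INR n * t ^ n)%R; [nra|].
    rewrite <- Eww, Rpow_mult_distr, <- Rmult_assoc.
    assert (Hwn : (0 < w ^ n)%R) by (apply pow_lt; lra).
    apply Rmult_le_compat_r; [lra|].
    assert (Hb := poly n _ Hi).
    replace (1 + (/ w - 1))%R with (/ w)%R in Hb by ring.
    rewrite pow_inv in Hb.
    apply Rmult_le_reg_r with (/ w - 1)%R; [lra|].
    rewrite Rinv_l by lra.
    apply (Rmult_le_compat_r (w ^ n)) in Hb; [|lra].
    rewrite Rinv_l in Hb by lra. nra.
  - apply is_lim_seq_const.
  - replace 0%R with (/ (/ w - 1) * 0)%R by ring.
    apply is_lim_seq_mult'; [apply is_lim_seq_const|].
    apply is_lim_seq_geom; rewrite Rabs_pos_eq; lra.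
Qed.

Lemma csum_geom_conv_0 (f : nat -> nat -> C) (B r : R) : (0 <= r < 1)%R ->
  (forall n k, (k < n)%nat -> (Cmod (f n k) <= B * r ^ n)%R) ->
  Cconv (fun n => csum (f n) n) 0.
Proof.
  intros Hr H.
  apply Cconv_of_le with (fun n => (B * (INR n * r ^ n))%R).
  - intros n. replace (csum (f n) n - 0) with (csum (f n) n) by ring.
    eapply Rle_trans; [apply csum_bound, H|]. lra.
  - replace 0%R with (B * 0)%R by ring.
    apply is_lim_seq_mult'; [apply is_lim_seq_const | now apply is_lim_seq_INR_pow].
Qed.

Definition WZ_pair (F G : nat -> nat -> C) : Prop :=
  forall n k, G n (S k) - G n k = F (S n) k - F n k.

(** Summing the WZ equation over k < n turns the staircase term into G n 0 + D (n+1) - D n, where D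
    n is the vertical segment of F from (n,0) to (n,n). The n terms of D n are O(r^n), so D tends to
    0. *)
Lemma WZ_diagonal (F G : nat -> nat -> C) (B r : R) (l : C) :
  WZ_pair F G -> (0 <= r < 1)%R ->
  (forall n k, (k < n)%nat -> (Cmod (F n k) <= B * r ^ n)%R) ->
  @is_series C_AbsRing C_NormedModule (fun n => G n O) l ->
  @is_series C_AbsRing C_NormedModule (fun n => G n n + F (S n) n) l.
Proof.
  intros HWZ Hr HF HG.
  set (D := fun n => csum (F n) n).
  apply is_series_ext with 
    (fun n => @plus (NormedModule.AbelianMonoid _ C_NormedModule)
                (G n O) (D (S n) - D n)).
  - intros n. unfold D; cbn [csum].
    assert (E := csum_telescope (G n) n).
    rewrite (csum_ext _ _ n (HWZ n)), csum_minus in E.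
    unfold plus; simpl.
    replace (G n n) with (csum (F (S n)) n - csum (F n) n + G n O)
      by (rewrite E; ring).
    ring.
  - replace l with (@plus (NormedModule.AbelianMonoid _ C_NormedModule) l (RtoC 0))
      by (unfold plus; simpl; ring).
    apply (@is_series_plus C_AbsRing C_NormedModule); [exact HG|].
    apply is_series_of_telescope with D; [reflexivity | reflexivity |].
    now apply csum_geom_conv_0 with B r.
Qed.

(** Path independence on a rectangle moves the sum of G from row 0 up to row N. There only the entry
    n = 0 survives in the limit, and the vertical side at n = N + 1 vanishes. *)
Lemma WZ_collapse (F G : nat -> nat -> C) (B r : R) (l : C) :
  WZ_pair F G -> (forall k, F O k = 0) -> (0 <= r < 1)%R ->
  (forall n k, (Cmod (F n k) <= B * r ^ n)%R) ->
  (forall n k, (Cmod (G (S n) k) <= B * r ^ k)%R) ->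
  Cconv (G O) l ->
  @is_series C_AbsRing C_NormedModule (fun n => G n O) l.
Proof.
  intros HWZ HF0 Hr HF HG Hl.
  apply is_series_of_telescope with (csum (fun n => G n O));
    [reflexivity | intros n; simpl; ring|].
  (* The left side of the rectangle contributes nothing because F 0 k = 0. *)
  assert (E : forall N M, csum (fun n => G n M) N - csum (F N) M
                          = csum (fun n => G n O) N).
  { intros N M; induction N as [|N IH].
    - simpl. rewrite (csum_ext (F O) (fun _ => 0 - 0))
        by (intros; rewrite HF0; ring).
      rewrite (csum_telescope (fun _ => 0)); ring.
    - cbn [csum]. rewrite <- IH.
      assert (T := csum_telescope (G N) M).
      rewrite (csum_ext _ _ M (HWZ N)), csum_minus in T.
      replace (G N M) with (csum (F (S N)) M - csum (F N) M + G N O)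
        by (rewrite T; ring).
      ring. }
  cut (Cconv (fun N => csum (fun n => G n O) (S N)) l).
  { unfold Cconv; intros H; now apply is_lim_seq_incr_1. }
  (* The rectangle has width N + 1 and height N, so that N terms remain once G 0 N is split off. *)
  apply Cconv_ext with
    (fun N => G O N
       + (csum (fun n => G (S n) N) N + (- (1)) * csum (F (S N)) N)).
  - intros N. rewrite <- (E (S N) N), csum_shift. ring.
  - replace l with (l + (0 + (- (1)) * 0)) by ring.
    apply Cconv_plus; [exact Hl|].
    apply Cconv_plus.
    + apply (csum_geom_conv_0 (fun N n => G (S n) N) B r); auto.
    + apply Cconv_mult; [apply Cconv_const|].
      apply (csum_geom_conv_0 (fun N => F (S N)) (B * r) r); auto.
      intros n k _. eapply Rle_trans; [apply HF|]. simpl; lra.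
Qed.

(** * Boundedness uniform in two indices *)

Definition bounded_on (D : nat -> nat -> Prop) (u : nat -> nat -> C) : Prop :=
  exists M, forall n k, D n k -> (Cmod (u n k) <= M)%R.

Definition inv_bounded_on (D : nat -> nat -> Prop) (u : nat -> nat -> C) : Prop :=
  (forall n k, D n k -> u n k <> 0) /\ bounded_on D (fun n k => / u n k).

Lemma bounded_on_le (D : nat -> nat -> Prop) (u : nat -> nat -> C) (M : R) :
  (forall n k, (Cmod (u n k) <= M)%R) -> bounded_on D u.
Proof. intros H; exists M; auto. Qed.

Lemma bounded_on_mult (D : nat -> nat -> Prop) (u v : nat -> nat -> C) :
  bounded_on D u -> bounded_on D v -> bounded_on D (fun n k => u n k * v n k).
Proof.
  intros [M HM] [N HN]. exists (M * N)%R; intros n k H.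
  rewrite Cmod_mult.
  apply Rmult_le_compat; auto using Cmod_ge_0.
Qed.

Lemma bounded_on_minus (D : nat -> nat -> Prop) (u v : nat -> nat -> C) :
  bounded_on D u -> bounded_on D v -> bounded_on D (fun n k => u n k - v n k).
Proof.
  intros [M HM] [N HN]. exists (M + N)%R; intros n k H.
  eapply Rle_trans; [apply Cmod_triangle|].
  rewrite Cmod_opp. apply Rplus_le_compat; auto.
Qed.

Lemma bounded_on_const (D : nat -> nat -> Prop) (c : C) :
  bounded_on D (fun _ _ => c).
Proof. apply bounded_on_le with (Cmod c); intros; lra. Qed.

Lemma bounded_on_pow (D : nat -> nat -> Prop) (u : nat -> nat -> C) (m : nat) :
  bounded_on D u -> bounded_on D (fun n k => u n k ^ m).
Proof.
  intros Hu; induction m as [|m IH].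
  - apply (bounded_on_const D 1).
  - apply (bounded_on_mult D u (fun n k => u n k ^ m) Hu IH).
Qed.

Lemma bounded_on_pow_nat (D : nat -> nat -> Prop) (p : C) (f : nat -> nat -> nat) :
  (Cmod p <= 1)%R -> bounded_on D (fun n k => p ^ f n k).
Proof.
  intros Hp; apply bounded_on_le with 1%R; intros; now apply Cmod_pow_le_1.
Qed.

Lemma bounded_on_div (D : nat -> nat -> Prop) (u v : nat -> nat -> C) :
  bounded_on D u -> inv_bounded_on D v -> bounded_on D (fun n k => u n k / v n k).
Proof. intros Hu [_ Hv]; now apply bounded_on_mult. Qed.

Lemma inv_bounded_on_mult (D : nat -> nat -> Prop) (u v : nat -> nat -> C) :
  inv_bounded_on D u -> inv_bounded_on D v ->
  inv_bounded_on D (fun n k => u n k * v n k).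
Proof.
  intros [Hu [M HM]] [Hv [N HN]]; split.
  - intros n k H; apply Cmult_neq_0; auto.
  - exists (M * N)%R; intros n k H.
    replace (/ (u n k * v n k)) with (/ u n k * / v n k) by (field; auto).
    rewrite Cmod_mult; apply Rmult_le_compat; auto using Cmod_ge_0.
Qed.

Lemma inv_bounded_on_pow (D : nat -> nat -> Prop) (u : nat -> nat -> C) (m : nat) :
  inv_bounded_on D u -> inv_bounded_on D (fun n k => u n k ^ m).
Proof.
  intros Hu; induction m as [|m IH].
  - split; simpl.
    + intros n k _ E; apply (f_equal fst) in E; simpl in E; lra.
    + apply bounded_on_const.
  - apply (inv_bounded_on_mult D u (fun n k => u n k ^ m) Hu IH).
Qed.

Lemma bounded_on_qpoch (D : nat -> nat -> Prop) (a p : C) (f : nat -> nat -> nat) :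
  (Cmod p < 1)%R -> bounded_on D (fun n k => qpoch a p (f n k)).
Proof.
  intros Hp; destruct (qpoch_bounded a p Hp) as [M HM].
  apply bounded_on_le with M; auto.
Qed.

Lemma inv_bounded_on_qpoch (D : nat -> nat -> Prop) (a p : C)
    (f : nat -> nat -> nat) :
  (Cmod a < 1)%R -> (Cmod p < 1)%R ->
  inv_bounded_on D (fun n k => qpoch a p (f n k)).
Proof.
  intros Ha Hp; destruct (qpoch_inv_bounded a p Ha Hp) as [M HM]; split.
  - auto using qpoch_neq_0.
  - apply bounded_on_le with M; auto.
Qed.

Lemma inv_bounded_on_one_minus (D : nat -> nat -> Prop) (a : C)
    (u : nat -> nat -> C) :
  (Cmod a < 1)%R -> (forall n k, (Cmod (u n k) <= 1)%R) ->
  inv_bounded_on D (fun n k => 1 - a * u n k).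
Proof.
  intros Ha Hu.
  assert (H : forall n k, (Cmod (a * u n k) <= Cmod a)%R).
  { intros n k; rewrite Cmod_mult.
    assert (H1 := Hu n k). assert (H2 := Cmod_ge_0 a). nra. }
  assert (N : forall n k, 1 - a * u n k <> 0).
  { intros n k; apply Cone_minus_neq_0; specialize (H n k); lra. }
  split; [auto|].
  apply bounded_on_le with (/ (1 - Cmod a))%R; intros n k.
  rewrite Cmod_inv by auto.
  apply Rinv_le_contravar; [lra|].
  assert (G := Cmod_one_minus_ge (a * u n k)). specialize (H n k). lra.
Qed.

(** For m < k, p^k - q p^m = -q p^m (1 - w p^(k-1-m)), which produces (w;p)_k; the remaining j
    factors p^k (1 - q p^i) produce (q;p)_j. The extracted monomials have modulus at most 1. *)
Lemma hpoch_diagonal_bound (q p w : C) (k j : nat) :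
  p = q * w -> (Cmod q <= 1)%R -> (Cmod p <= 1)%R ->
  (Cmod (hpoch (p ^ k) q p (k + j))
   <= Cmod (qpoch w p k) * Cmod (qpoch q p j))%R.
Proof.
  intros Ep Hq Hp; induction k as [|k IH].
  - simpl. rewrite hpoch_qpoch, Cmod_1. lra.
  - rewrite Cpow_S. cbn [Nat.add]. rewrite hpoch_scale. cbn [qpoch].
    replace ((p * p ^ k - q) * p ^ (k + j))
      with (- (q * p ^ (k + j)) * (1 - w * p ^ k))
      by (generalize (p ^ k) (p ^ (k + j)); intros; rewrite Ep; ring).
    rewrite !Cmod_mult, Cmod_opp, Cmod_mult.
    assert (H1 := Cmod_pow_le_1 p (k + j) Hp).
    assert (H2 := Cmod_ge_0 (p ^ (k + j))).
    assert (H3 := Cmod_ge_0 q).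
    assert (H4 := Cmod_ge_0 (1 - w * p ^ k)).
    assert (H5 := Cmod_ge_0 (hpoch (p ^ k) q p (k + j))).
    set (a := Cmod (1 - w * p ^ k)) in *.
    set (b := Cmod (hpoch (p ^ k) q p (k + j))) in *.
    apply Rle_trans with (1 * a * b)%R.
    + apply Rmult_le_compat_r; [assumption|].
      apply Rmult_le_compat_r; [assumption|]. nra.
    + apply (Rmult_le_compat_l a) in IH; [|assumption]. lra.
Qed.

Ltac bound_tac :=
  repeat lazymatch goal with
    | |- bounded_on _ (fun _ _ => _ / _) => apply bounded_on_div
    | |- bounded_on _ (fun _ _ => _ * _) => apply bounded_on_mult
    | |- bounded_on _ (fun _ _ => _ - _) => apply bounded_on_minus
    | |- bounded_on _ (fun _ _ => qpoch _ _ _) => apply bounded_on_qpoch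
    | |- bounded_on _ (fun _ _ => _ ^ _) =>
        first [apply bounded_on_pow | apply bounded_on_pow_nat]
    | |- bounded_on _ (fun _ _ => _) => apply bounded_on_const
    | |- inv_bounded_on _ (fun _ _ => _ * _) => apply inv_bounded_on_mult
    | |- inv_bounded_on _ (fun _ _ => _ ^ _) => apply inv_bounded_on_pow
    | |- inv_bounded_on _ (fun _ _ => qpoch _ _ _) => apply inv_bounded_on_qpoch
    end; try assumption; try (apply Rlt_le; assumption).

(** * Geometric decay of the 6phi5 pairs *)

Lemma bounded_on_hpoch (D : nat -> nat -> Prop) (x y p : C) :
  (Cmod p < 1)%R -> (Cmod x <= 1)%R -> bounded_on D (fun n _ => hpoch x y p n).
Proof.
  intros Hp Hx; destruct (hpoch_bounded x y p Hp Hx) as [M HM].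
  apply bounded_on_le with M; auto.
Qed.

Lemma Cmod_mult_le_1 (a b : C) :
  (Cmod a <= 1)%R -> (Cmod b <= 1)%R -> (Cmod (a * b) <= 1)%R.
Proof.
  intros Ha Hb; rewrite Cmod_mult.
  assert (H1 := Cmod_ge_0 a). assert (H2 := Cmod_ge_0 b). nra.
Qed.

Lemma Cmod_mult_lt_1 (a b : C) :
  (Cmod a < 1)%R -> (Cmod b <= 1)%R -> (Cmod (a * b) < 1)%R.
Proof.
  intros Ha Hb; rewrite Cmod_mult.
  assert (H1 := Cmod_ge_0 a). assert (H2 := Cmod_ge_0 b). nra.
Qed.

Lemma parameter_bounds (q x y s p : C) :
  p = q * s * y -> (Cmod q < 1)%R -> (Cmod s < 1)%R ->
  (Cmod x <= 1)%R -> (Cmod y <= 1)%R ->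
  (Cmod p < 1)%R /\ (Cmod (s * x) < 1)%R /\ (Cmod (q * (q * s * x)) < 1)%R.
Proof.
  intros -> Hq Hs Hx Hy.
  assert (Hqs : (Cmod (q * s) < 1)%R) by (apply Cmod_mult_lt_1; lra).
  repeat split; repeat apply Cmod_mult_lt_1; try apply Rlt_le, Cmod_mult_lt_1; lra.
Qed.

(** The term supplies s^n and the certificate one more s; what remains is bounded uniformly on k <=
    n. *)
Lemma bshiftF_bound (q x y s p : C) :
  p = q * s * y -> (Cmod q < 1)%R -> (Cmod s < 1)%R ->
  (Cmod x <= 1)%R -> (Cmod y <= 1)%R ->
  exists B, forall n k, (k < n)%nat ->
    (Cmod (bshiftF q x y s p n k) <= B * Cmod s ^ n)%R.
Proof.
  intros Ep Hq Hs Hx Hy.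
  destruct (parameter_bounds q x y s p Ep Hq Hs Hx Hy) as (Hp & Hsx & Ht).
  set (D := fun n k : nat => (k <= n)%nat).
  assert (HU : bounded_on D (fun n k =>
    qpoch q p n ^ 2 * hpoch (p ^ k) q p n * hpoch x y p n
    / (qpoch p p n ^ 2 * qpoch p p (n + k) * qpoch (q * (q * s * x)) p n)
    * (qpoch (s * y) p k * qpoch (q * s * x) p k / qpoch (s * x) p k)
    * (p ^ k * (1 - q * p ^ n) ^ 2 * (x - y * p ^ n)
       / ((1 - p * (p ^ n * p ^ k)) * (1 - s * x * p ^ k))))).
  { bound_tac.
    - destruct (qpoch_bounded (s * y) p Hp) as [M HM].
      destruct (qpoch_bounded q p Hp) as [N HN].
      (* By p = q (s y), [hpoch_diagonal_bound] applies with w = s y and j = n - k. *)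
      exists (M * N)%R; intros n k Hk.
      replace n with (k + (n - k))%nat by (unfold D in Hk; lia).
      eapply Rle_trans.
      + apply (hpoch_diagonal_bound q p (s * y)); [rewrite Ep; ring | lra | lra].
      + apply Rmult_le_compat; auto using Cmod_ge_0.
    - now apply bounded_on_hpoch.
    - apply (inv_bounded_on_one_minus D p (fun n k => p ^ n * p ^ k)); [assumption|].
      intros; apply Cmod_mult_le_1; apply Cmod_pow_le_1; lra.
    - apply (inv_bounded_on_one_minus D (s * x) (fun n k => p ^ k)); [assumption|].
      intros; apply Cmod_pow_le_1; lra. }
  destruct HU as [M HM].
  exists M; intros [|n] k Hk; [lia|].
  assert (Hk' : D n k) by (unfold D; lia).
  specialize (HM n k Hk').
  match type of HM with (Cmod ?u <= M)%R =>
    replace (bshiftF q x y s p (S n) k) with (u * s ^ S n) end.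
  - rewrite Cmod_mult, Cmod_pow.
    apply Rmult_le_compat_r; [apply pow_le, Cmod_ge_0 | exact HM].
  - cbn [bshiftF]; unfold bshiftT, bshiftR, Cdiv. rewrite (Cpow_S s n). ring.
Qed.

Lemma ashiftF_bound (q x y s p : C) :
  p = q * s * y -> (Cmod q < 1)%R -> (Cmod s < 1)%R ->
  (Cmod x <= 1)%R -> (Cmod y <= 1)%R ->
  exists B, forall n k, (Cmod (ashiftF q x y s p n k) <= B * Cmod s ^ n)%R.
Proof.
  intros Ep Hq Hs Hx Hy.
  destruct (parameter_bounds q x y s p Ep Hq Hs Hx Hy) as (Hp & Hsx & Ht).
  set (D := fun _ _ : nat => True).
  assert (HU : bounded_on D (fun n m =>
    qpoch q p (n + m) * qpoch q p n ^ 2 * hpoch x y p n * p ^ (m * n)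
    / (qpoch p p n * qpoch p p (n + m) ^ 2 * qpoch (q * (q * s * x)) p (n + m))
    * (qpoch (s * y) p m * qpoch (q * s * x) p m ^ 2 / qpoch (s * x) p m)
    * (p ^ m * (1 - q * p ^ n) ^ 2 * (x - y * p ^ n) * (1 - q * (p ^ n * p ^ m))
       * (1 - s * y * (q * (q * s * x)) * (p ^ n * (p ^ m) ^ 2))
       / ((1 - s * x * p ^ m) * (1 - p * (p ^ n * p ^ m)) ^ 2
          * (1 - q * (q * s * x) * (p ^ n * p ^ m)))))).
  { bound_tac.
    - now apply bounded_on_hpoch.
    - apply (inv_bounded_on_one_minus D (s * x) (fun n k => p ^ k)); [assumption|].
      intros; apply Cmod_pow_le_1; lra.
    - apply (inv_bounded_on_one_minus D p (fun n k => p ^ n * p ^ k)); [assumption|].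
      intros; apply Cmod_mult_le_1; apply Cmod_pow_le_1; lra.
    - apply (inv_bounded_on_one_minus D _ (fun n k => p ^ n * p ^ k)); [assumption|].
      intros; apply Cmod_mult_le_1; apply Cmod_pow_le_1; lra. }
  destruct HU as [M HM].
  (* The maximum with 0 covers n = 0, where [ashiftF] is 0 but the sign of [M] is unknown. *)
  exists (Rmax M 0); intros [|n] k.
  { cbn [ashiftF]; rewrite Cmod_0; simpl. assert (H := Rmax_r M 0). lra. }
  assert (H := Rmax_l M 0). specialize (HM n k I).
  match type of HM with (Cmod ?u <= M)%R =>
    replace (ashiftF q x y s p (S n) k) with (u * s ^ S n) end.
  - rewrite Cmod_mult, Cmod_pow.
    apply Rmult_le_compat_r; [apply pow_le, Cmod_ge_0 | lra].
  - cbn [ashiftF]; unfold ashiftT, ashiftR, Cdiv.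
    rewrite (Cpow_S s n), (Cpow_mult_r p). ring.
Qed.

(** The decay comes from (p^k)^(n+1) = p^k p^(kn), which requires a positive first index; the row
    entry of index 0 does not decay this way. *)
Lemma ashiftG_bound (q x y s p : C) :
  p = q * s * y -> (Cmod q < 1)%R -> (Cmod s < 1)%R ->
  (Cmod x <= 1)%R -> (Cmod y <= 1)%R ->
  exists B, forall n k, (Cmod (ashiftG q x y s p (S n) k) <= B * Cmod p ^ k)%R.
Proof.
  intros Ep Hq Hs Hx Hy.
  destruct (parameter_bounds q x y s p Ep Hq Hs Hx Hy) as (Hp & Hsx & Ht).
  set (D := fun _ _ : nat => True).
  assert (HU : bounded_on D (fun n m =>
    (1 - q * (p ^ S n) ^ 2 * p ^ m) *
    (qpoch q p (S n + m) * qpoch q p (S n) ^ 2 * hpoch x y p (S n) * s ^ S n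
     * p ^ (m * n)
    / (qpoch p p (S n) * qpoch p p (S n + m) ^ 2
       * qpoch (q * (q * s * x)) p (S n + m))
    * (qpoch (s * y) p m * qpoch (q * s * x) p m ^ 2 / qpoch (s * x) p m)))).
  { bound_tac.
    destruct (hpoch_bounded x y p Hp Hx) as [M HM].
    apply bounded_on_le with M; auto. }
  destruct HU as [M HM].
  exists M; intros n k. specialize (HM n k I).
  match type of HM with (Cmod ?u <= M)%R =>
    replace (ashiftG q x y s p (S n) k) with (u * p ^ k) end.
  - rewrite Cmod_mult, Cmod_pow.
    apply Rmult_le_compat_r; [apply pow_le, Cmod_ge_0 | exact HM].
  - unfold ashiftG, ashiftT, Cdiv. rewrite (Cpow_S (p ^ k) n), (Cpow_mult_r p). ring.
Qed.

(** * Evaluation of the 6phi5 series and of its diagonal staircase *)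

(** By [WZ_collapse] the sum is the limit of [ashiftG] at n = 0 as m grows, a quotient of infinite
    products. *)
Lemma ashift_series (q x y s p : C) :
  p = q * s * y -> (Cmod q < 1)%R -> (Cmod s < 1)%R ->
  (Cmod x <= 1)%R -> (Cmod y <= 1)%R ->
  @is_series C_AbsRing C_NormedModule (fun n => ashiftG q x y s p n O)
    (qpoch_inf q p * qpoch_inf (s * y) p * qpoch_inf (q * s * x) p ^ 2
     / (qpoch_inf p p ^ 2 * qpoch_inf (q * (q * s * x)) p * qpoch_inf (s * x) p)).
Proof.
  intros Ep Hq Hs Hx Hy.
  destruct (parameter_bounds q x y s p Ep Hq Hs Hx Hy) as (Hp & Hsx & Ht).
  destruct (ashiftF_bound q x y s p Ep Hq Hs Hx Hy) as [B1 HB1].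
  destruct (ashiftG_bound q x y s p Ep Hq Hs Hx Hy) as [B2 HB2].
  (* F decays like |s|^n and G like |p|^k with separate constants; [WZ_collapse] wants a single B
     and r, and B >= 0 allows the base to be enlarged to r. *)
  set (r := Rmax (Cmod s) (Cmod p)). set (B := Rmax 0 (Rmax B1 B2)).
  assert (Hs0 := Cmod_ge_0 s). assert (Hp0 := Cmod_ge_0 p).
  assert (R1 : (Cmod s <= r)%R) by apply Rmax_l.
  assert (R2 : (Cmod p <= r)%R) by apply Rmax_r.
  assert (L0 : (0 <= B)%R) by apply Rmax_l.
  assert (L1 : (B1 <= B)%R) by (eapply Rle_trans; [|apply Rmax_r]; apply Rmax_l).
  assert (L2 : (B2 <= B)%R) by (eapply Rle_trans; [|apply Rmax_r]; apply Rmax_r).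
  assert (Hr : (0 <= r < 1)%R) by (split; [lra | now apply Rmax_lub_lt]).
  assert (W : forall a c b n, (a <= c * b ^ n)%R -> (0 <= b <= r)%R ->
                (c <= B)%R -> (a <= B * r ^ n)%R).
  { intros a c b n H1 H2 H3. eapply Rle_trans; [apply H1|].
    apply Rle_trans with (B * b ^ n)%R.
    - apply Rmult_le_compat_r; [apply pow_le; lra | assumption].
    - apply Rmult_le_compat_l; [assumption | now apply pow_incr]. }
  apply (WZ_collapse (ashiftF q x y s p) (ashiftG q x y s p) B r).
  - intros n k; now apply ashift_WZ.
  - reflexivity.
  - exact Hr.
  - intros n k; eapply W; [apply HB1 | lra | exact L1].
  - intros n k; eapply W; [apply HB2 | lra | exact L2].
  (* The factor 1 - q p^m merges with (q;p)_m into (q;p)_(m+1). *)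
  - apply Cconv_ext with (fun m =>
      qpoch q p (S m) * (qpoch (s * y) p m * (qpoch (q * s * x) p m
        * (qpoch (q * s * x) p m * (/ qpoch p p m * (/ qpoch p p m
        * (/ qpoch (q * (q * s * x)) p m * / qpoch (s * x) p m))))))).
    { intros m. unfold ashiftG, ashiftT. cbn [qpoch hpoch Cpow Nat.add].
      field. repeat split; auto using qpoch_neq_0. }
    replace (qpoch_inf q p * qpoch_inf (s * y) p * qpoch_inf (q * s * x) p ^ 2
     / (qpoch_inf p p ^ 2 * qpoch_inf (q * (q * s * x)) p * qpoch_inf (s * x) p))
    with (qpoch_inf q p * (qpoch_inf (s * y) p * (qpoch_inf (q * s * x) p
        * (qpoch_inf (q * s * x) p * (/ qpoch_inf p p * (/ qpoch_inf p p
        * (/ qpoch_inf (q * (q * s * x)) p * / qpoch_inf (s * x) p)))))))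
    by (field; repeat split; auto using qpoch_inf_neq_0).
    repeat apply Cconv_mult; auto using qpoch_inf_conv, qpoch_inf_inv_conv.
    assert (H := qpoch_inf_conv q p Hp). unfold Cconv in *.
    now apply is_lim_seq_incr_1 in H.
Qed.

Lemma bshift_diagonal_series (q x y s p : C) :
  p = q * s * y -> (Cmod q < 1)%R -> (Cmod s < 1)%R ->
  (Cmod x <= 1)%R -> (Cmod y <= 1)%R ->
  @is_series C_AbsRing C_NormedModule
    (fun n => bshiftG q x y s p n n + bshiftF q x y s p (S n) n)
    (qpoch_inf q p * qpoch_inf (s * y) p * qpoch_inf (q * s * x) p ^ 2
     / (qpoch_inf p p ^ 2 * qpoch_inf (q * (q * s * x)) p * qpoch_inf (s * x) p)).
Proof.
  intros Ep Hq Hs Hx Hy.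
  destruct (parameter_bounds q x y s p Ep Hq Hs Hx Hy) as (Hp & Hsx & Ht).
  destruct (bshiftF_bound q x y s p Ep Hq Hs Hx Hy) as [B HB].
  apply (WZ_diagonal _ _ B (Cmod s)).
  - intros n k; now apply bshift_WZ.
  - split; [apply Cmod_ge_0 | exact Hs].
  - exact HB.
  (* With no shift both families reduce to the same 6phi5 series with a = b = c = q. *)
  - eapply is_series_ext; [|now apply ashift_series].
    intros n. unfold ashiftG, bshiftG, ashiftT, bshiftT. simpl.
    rewrite hpoch_qpoch, Nat.add_0_r, Cpow_1_l.
    field; repeat split; auto using qpoch_neq_0.
Qed.

(** * The quadratic pair along k = 2n *)

(** The prefactor q and one of the four factors q^n give q^(n+1). *)
Lemma quadF_bound (q : C) : (Cmod q < 1)%R ->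
  exists B, forall n j, (Cmod (quadF q n j) <= B * Cmod q ^ S n)%R.
Proof.
  intros Hq.
  assert (H2 := Cmod_pow_lt_1 q 1 Hq). assert (H4 := Cmod_pow_lt_1 q 3 Hq).
  set (D := fun _ _ : nat => True).
  assert (HU : bounded_on D (fun n j =>
    (- (1)) ^ n * q ^ (2 * n ^ 2)
    * qpoch (q ^ 2) (q ^ 4) n * qpoch (q ^ 2) (q ^ 4) (n + j)
    * qpoch q (q ^ 2) (n + (n + j))
    / (qpoch (q ^ 4) (q ^ 4) n ^ 2 * qpoch (q ^ 4) (q ^ 4) (n + (n + j))
       * qpoch q (q ^ 2) j)
    * ((q ^ n) ^ 3 * (q ^ j) ^ 2 * (1 - q ^ 2 * (q ^ n) ^ 4)
       * (1 - q * ((q ^ n) ^ 4 * (q ^ j) ^ 2))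
       / (1 - q ^ 4 * ((q ^ n) ^ 8 * (q ^ j) ^ 4))))).
  { bound_tac.
    - rewrite Cmod_opp, Cmod_1; lra.
    - apply (inv_bounded_on_one_minus D _ (fun n j => (q ^ n) ^ 8 * (q ^ j) ^ 4));
        [assumption|].
      intros; apply Cmod_mult_le_1; repeat apply Cmod_pow_le_1; lra. }
  destruct HU as [M HM].
  exists M; intros n k. specialize (HM n k I).
  match type of HM with (Cmod ?u <= M)%R =>
    replace (quadF q n k) with (u * q ^ S n) end.
  - rewrite Cmod_mult, Cmod_pow.
    apply Rmult_le_compat_r; [apply pow_le, Cmod_ge_0 | exact HM].
  - unfold quadF, quadT, Cdiv. rewrite (Cpow_S q n). ring.
Qed.

(** The staircases along k = n and k = 2n are joined at column n by D n, the sum of F n k over n <=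
    k < 2n. Their terms differ by D (n+1) - D n, and D tends to 0. *)
Lemma quad_double_diagonal_series (q l : C) : (Cmod q < 1)%R ->
  @is_series C_AbsRing C_NormedModule (fun n => quadG q n O + quadF q n O) l ->
  @is_series C_AbsRing C_NormedModule
    (fun n => quadG q n n + quadF q n n + quadF q n (S n)) l.
Proof.
  intros Hq Hl.
  destruct (quadF_bound q Hq) as [B HB].
  (* [f n j] is F n (n+j). The default at n = 0 is never summed, since D 0 is empty. *)
  set (f := fun n j => match n with O => RtoC 0 | S m => quadF q m (S j) end).
  set (D := fun n => csum (f n) n).
  apply is_series_ext with
    (fun n => @plus (NormedModule.AbelianMonoid _ C_NormedModule)
                (quadG q n O + quadF q n O) (D (S n) - D n)).
  - intros n.
    change (quadG q n O + quadF q n O + (D (S n) - D n)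
            = quadG q n n + quadF q n n + quadF q n (S n)).
    (* [quad_WZ] covers only columns n >= 1; at n = 0 both sides agree directly. *)
    destruct n as [|n]; unfold D; [simpl; ring|].
    assert (T := csum_telescope (quadG q (S n)) (S n)).
    rewrite (csum_ext _ _ (S n) (fun j => quad_WZ q n j Hq)), csum_minus in T.
    replace (csum (f (S n)) (S n))
      with (csum (quadF q (S n)) (S n) - (quadG q (S n) (S n) - quadG q (S n) O))
      by (rewrite <- T; unfold f; ring).
    rewrite (csum_shift (quadF q (S n)) n).
    change (csum (f (S (S n))) (S (S n)))
      with (csum (fun k => quadF q (S n) (S k)) n + quadF q (S n) (S n)
            + quadF q (S n) (S (S n))).
    ring.
  - replace l with (@plus (NormedModule.AbelianMonoid _ C_NormedModule) l (RtoC 0))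
      by (unfold plus; simpl; ring).
    apply (@is_series_plus C_AbsRing C_NormedModule); [exact Hl|].
    apply is_series_of_telescope with D; [reflexivity | reflexivity |].
    apply csum_geom_conv_0 with B (Cmod q).
    + split; [apply Cmod_ge_0 | exact Hq].
    + intros [|n] k Hk; [lia | apply HB].
Qed.

(** * Identification of the summands *)

Lemma qpoch_double (q : C) (n : nat) :
  qpoch q (q ^ 2) (n + n) = qpoch q (q ^ 4) n * qpoch (q ^ 3) (q ^ 4) n.
Proof.
  induction n as [|n IH]; [simpl; ring|].
  rewrite Nat.add_succ_r; cbn [Nat.add qpoch]. rewrite IH.
  rewrite !(Cpow_pow_comm q 4), !(Cpow_pow_comm q 2), (Cpow_S q (n + n)), !Cpow_add_r.
  ring.
Qed.

(** Each factor is q^(4n) - q^(4m+1) = -q^(4m+1) (1 - q^(4(n-m)-1)); the exponents 4m+1 add up to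
    2n^2 - n, which q^n completes. *)
Lemma hpoch_diagonal (q : C) (n : nat) :
  hpoch ((q ^ 4) ^ n) q (q ^ 4) n * q ^ n
  = (- (1)) ^ n * q ^ (2 * n ^ 2) * qpoch (q ^ 3) (q ^ 4) n.
Proof.
  induction n as [|n IH]; [simpl; ring|].
  rewrite (Cpow_S (q ^ 4) n), hpoch_scale, Cpow_double_square_S.
  rewrite (Cpow_S q n), (Cpow_S (- (1)) n). cbn [qpoch].
  replace ((q ^ 4 * (q ^ 4) ^ n - q) * (q ^ 4) ^ n
           * hpoch ((q ^ 4) ^ n) q (q ^ 4) n * (q * q ^ n))
    with ((q ^ 4 * (q ^ 4) ^ n - q) * (q ^ 4) ^ n * q
           * (hpoch ((q ^ 4) ^ n) q (q ^ 4) n * q ^ n)) by ring.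
  rewrite IH, !(Cpow_pow_comm q 4). ring.
Qed.

(** The case d = oo of the 6phi5 parameter: the factors are -q^(4m), with exponents adding up to
    2n^2 - 2n. *)
Lemma hpoch_0_1 (q : C) (n : nat) :
  hpoch 0 1 (q ^ 4) n * (q ^ 2) ^ n = (- (1)) ^ n * q ^ (2 * n ^ 2).
Proof.
  induction n as [|n IH]; [simpl; ring|].
  rewrite Cpow_double_square_S, (Cpow_S (q ^ 2) n), (Cpow_S (- (1)) n).
  cbn [hpoch].
  replace (hpoch 0 1 (q ^ 4) n * (0 - 1 * (q ^ 4) ^ n) * (q ^ 2 * (q ^ 2) ^ n))
    with (hpoch 0 1 (q ^ 4) n * (q ^ 2) ^ n * (- (q ^ 4) ^ n * q ^ 2)) by ring.
  rewrite IH, (Cpow_pow_comm q 4). ring.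
Qed.

Lemma Cpow_m1_sqr (n : nat) : (- (1)) ^ n * (- (1)) ^ n = 1.
Proof.
  rewrite <- Cpow_mult_l. replace (- (1) * - (1)) with (RtoC 1) by ring.
  apply Cpow_1_l.
Qed.

Lemma qpoch_0 (p : C) (n : nat) : qpoch 0 p n = 1.
Proof. induction n as [|n IH]; simpl; [|rewrite IH]; ring. Qed.

Lemma qpoch_inf_0 (p : C) : qpoch_inf 0 p = 1.
Proof.
  apply (@iota_filterlim_locally C_AbsRing C_CompleteNormedModule nat eventually _
           (qpoch 0 p)).
  apply Cconv_filterlim.
  apply Cconv_ext with (fun _ => RtoC 1); [|apply Cconv_const].
  intros n; now rewrite qpoch_0.
Qed.

Lemma Cpow_affine (q : C) (a b n : nat) : q ^ (a * n + b) = (q ^ n) ^ a * q ^ b.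
Proof. now rewrite Cpow_add_r, Cpow_mult_r, Cpow_pow_comm. Qed.

Lemma quadT_bshiftT (q : C) (n : nat) : (Cmod q < 1)%R ->
  quadT q n O = bshiftT q 1 (q ^ 2) q (q ^ 4) n n.
Proof.
  intros Hq.
  assert (H3 := Cmod_pow_lt_1 q 2 Hq). assert (H4 := Cmod_pow_lt_1 q 3 Hq).
  unfold quadT, bshiftT.
  rewrite Nat.add_0_r, qpoch_double, hpoch_qpoch. cbn [qpoch].
  replace (q * (q * q * 1)) with (q ^ 3) by ring.
  replace (q * q ^ 2) with (q ^ 3) by ring.
  replace (q * q * 1) with (q ^ 2) by ring.
  replace (q * 1) with q by ring.
  replace (qpoch q (q ^ 4) n ^ 2 * hpoch ((q ^ 4) ^ n) q (q ^ 4) n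
           * qpoch (q ^ 2) (q ^ 4) n * q ^ n)
    with (qpoch q (q ^ 4) n ^ 2 * qpoch (q ^ 2) (q ^ 4) n
          * (hpoch ((q ^ 4) ^ n) q (q ^ 4) n * q ^ n)) by ring.
  rewrite hpoch_diagonal.
  field. repeat split; auto using qpoch_neq_0.
Qed.

(** The link between the 6phi5 pair with d = q^2 and the quadratic pair: different F and G, but the
    same diagonal staircase. *)
Lemma quad_bshift_diagonal (q : C) (n : nat) : (Cmod q < 1)%R ->
  bshiftG q 1 (q ^ 2) q (q ^ 4) n n + bshiftF q 1 (q ^ 2) q (q ^ 4) (S n) n
  = quadG q n O + quadF q n O.
Proof.
  intros Hq.
  assert (H4 := Cmod_pow_lt_1 q 3 Hq).
  (* [Cmod_pow_lt_1] bounds successor exponents, so these two facts concern 1 - q^(4n+1) and 1 -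
     q^(8n+4). *)
  assert (D1 := Cone_minus_neq_0 _ (Cmod_pow_lt_1 q (4 * n) Hq)).
  assert (D2 := Cone_minus_neq_0 _ (Cmod_pow_lt_1 q (8 * n + 3) Hq)).
  unfold bshiftG, bshiftF, bshiftR, quadG, quadF. rewrite (quadT_bshiftT q n Hq).
  revert D1 D2.
  replace (S (8 * n + 3)) with (8 * n + 4)%nat by lia.
  replace (S (4 * n)) with (4 * n + 1)%nat by lia.
  rewrite !Cpow_affine, !(Cpow_pow_comm q 4).
  generalize (bshiftT q 1 (q ^ 2) q (q ^ 4) n n) (q ^ n).
  cbn [Cpow]; intros T A D1 D2.
  field. repeat split.
  all: intro Z; first [apply D1; rewrite <- Z; ring | apply D2; rewrite <- Z; ring].
Qed.

Lemma sum1_term (q : C) (n : nat) : (Cmod q < 1)%R ->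
  (- (1)) ^ n * q ^ (2 * n ^ 2)
    * qpoch (q ^ 2) (q ^ 4) n ^ 2 * qpoch q (q ^ 2) (2 * n)
  / (qpoch (q ^ 4) (q ^ 4) n ^ 2 * qpoch (q ^ 4) (q ^ 4) (2 * n))
  * (qnum q (8 * n + 1)
     + qnum q (4 * n + 1) * (q ^ (4 * n + 1) / (1 + q ^ (4 * n + 2))))
  = / (1 - q) * (quadG q n O + quadF q n O).
Proof.
  intros Hq.
  assert (H4 := Cmod_pow_lt_1 q 3 Hq).
  assert (D0 := Cone_minus_neq_0 _ Hq).
  assert (D1 := Cone_minus_neq_0 _ (Cmod_pow_lt_1 q (8 * n + 3) Hq)).
  assert (P1 : forall l, qpoch (q ^ 4) (q ^ 4) l <> 0) by (intros; nonzero).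
  unfold quadG, quadF, quadT, qnum.
  replace (2 * n)%nat with (n + n)%nat by lia.
  rewrite Nat.add_0_r. revert D1.
  replace (S (8 * n + 3)) with (8 * n + 4)%nat by lia.
  rewrite !Cpow_affine. cbn [qpoch].
  generalize (P1 n) (P1 (n + n)%nat).
  generalize (qpoch (q ^ 4) (q ^ 4) n) (qpoch (q ^ 4) (q ^ 4) (n + n)%nat)
    (qpoch (q ^ 2) (q ^ 4) n) (qpoch q (q ^ 2) (n + n)) (q ^ n)
    (q ^ (2 * n ^ 2)) ((- (1)) ^ n).
  intros d1 d2 a1 a2 A a3 a4 N1 N2 D1.
  (* 1 + q^(4n+2) divides 1 - q^(8n+4), whose nonvanishing is known. *)
  assert (D2 : 1 + A ^ 4 * q ^ 2 <> 0).
  { intro Z; apply D1.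
    replace (1 - A ^ 8 * q ^ 4) with ((1 + A ^ 4 * q ^ 2) * (1 - A ^ 4 * q ^ 2))
      by ring.
    rewrite Z; ring. }
  cbn [Cpow] in *. field. repeat split; auto.
  all: intro Z; first [apply D1; rewrite <- Z; ring | apply D2; rewrite <- Z; ring].
Qed.

(** The three terms in the bracket come in order from [quadG q n n], [quadF q n n] and
    [quadF q n (S n)]. In the last, (1 - q^(4n+2))/(1 - q^(2n+1)) leaves the factor 1 + q^(2n+1). *)
Lemma sum2_term (q : C) (n : nat) : (Cmod q < 1)%R ->
  (- (1)) ^ n * q ^ (2 * n ^ 2)
    * qpoch (q ^ 2) (q ^ 4) n * qpoch (q ^ 2) (q ^ 4) (2 * n)
    * qpoch q (q ^ 2) (3 * n)
  / (qpoch (q ^ 4) (q ^ 4) n ^ 2 * qpoch (q ^ 4) (q ^ 4) (3 * n)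
     * qpoch q (q ^ 2) n)
  * (qnum q (10 * n + 1)
     + q ^ (6 * n + 1) * qnum q (4 * n + 2) * qnum q (6 * n + 1)
       / qnum q (12 * n + 4)
     + q ^ (6 * n + 3) * qnum q (6 * n + 1) * qnum q (6 * n + 3)
       * qnum q (8 * n + 2) * (1 + q ^ (2 * n + 1))
       / (qnum q (12 * n + 4) * qnum q (12 * n + 8)))
  = / (1 - q) * (quadG q n n + quadF q n n + quadF q n (S n)).
Proof.
  intros Hq.
  assert (H2 := Cmod_pow_lt_1 q 1 Hq). assert (H4 := Cmod_pow_lt_1 q 3 Hq).
  assert (D0 := Cone_minus_neq_0 _ Hq).
  assert (D1 := Cone_minus_neq_0 _ (Cmod_pow_lt_1 q (12 * n + 3) Hq)).
  assert (D2 := Cone_minus_neq_0 _ (Cmod_pow_lt_1 q (12 * n + 7) Hq)).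
  assert (D3 := Cone_minus_neq_0 _ (Cmod_pow_lt_1 q (2 * n) Hq)).
  assert (P1 : forall l, qpoch (q ^ 4) (q ^ 4) l <> 0) by (intros; nonzero).
  assert (P2 : forall l, qpoch q (q ^ 2) l <> 0) by (intros; nonzero).
  unfold quadG, quadF, quadT, qnum.
  replace (2 * n)%nat with (n + n)%nat by lia.
  replace (3 * n)%nat with (n + (n + n))%nat by lia.
  rewrite !(Nat.add_succ_r n). revert D1 D2 D3.
  replace (S (12 * n + 3)) with (12 * n + 4)%nat by lia.
  replace (S (12 * n + 7)) with (12 * n + 8)%nat by lia.
  replace (S (2 * n)) with (2 * n + 1)%nat by lia.
  replace (n + n + 1)%nat with (2 * n + 1)%nat by lia.
  rewrite !Cpow_affine. cbn [qpoch].
  generalize (P1 n) (P1 (n + (n + n))%nat) (P2 n).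
  generalize (qpoch (q ^ 4) (q ^ 4) n) (qpoch (q ^ 4) (q ^ 4) (n + (n + n))%nat)
    (qpoch (q ^ 2) (q ^ 4) n) (qpoch (q ^ 2) (q ^ 4) (n + n))
    (qpoch q (q ^ 2) (n + (n + n))) (qpoch q (q ^ 2) n)
    (q ^ (2 * n ^ 2)) ((- (1)) ^ n).
  rewrite !(Cpow_pow_comm q 4), !(Cpow_pow_comm q 2), !(Cpow_S q n), !Cpow_add_r.
  generalize (q ^ n).
  intros A d1 d2 a1 a2 a3 d3 a4 a5 N1 N2 N3 D1 D2 D3.
  field. repeat split; auto.
  all: intro Z; first [apply D1; rewrite <- Z; ring | apply D2; rewrite <- Z; ring
                      |apply D3; rewrite <- Z; ring].
Qed.

(** Here d = oo, that is x = 0, y = 1, s = q^3. Splitting (q^3)^n as q^n (q^2)^n feeds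
    [hpoch_diagonal] and [hpoch_0_1]; their signs cancel and their powers combine to q^(4n^2). *)
Lemma sum3_term (q : C) (n : nat) : (Cmod q < 1)%R ->
  q ^ (4 * n ^ 2) * qpoch q (q ^ 2) (2 * n) ^ 2
  / (qpoch (q ^ 4) (q ^ 4) n ^ 2 * qpoch (q ^ 4) (q ^ 4) (2 * n))
  * (qnum q (8 * n + 1)
     - q ^ (8 * n + 3) * (qnum q (4 * n + 1) ^ 2 / qnum q (8 * n + 4)))
  = / (1 - q) * (bshiftG q 0 1 (q ^ 3) (q ^ 4) n n
                 + bshiftF q 0 1 (q ^ 3) (q ^ 4) (S n) n).
Proof.
  intros Hq.
  assert (H4 := Cmod_pow_lt_1 q 3 Hq).
  assert (D0 := Cone_minus_neq_0 _ Hq).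
  assert (D1 := Cone_minus_neq_0 _ (Cmod_pow_lt_1 q (8 * n + 3) Hq)).
  assert (P1 : forall l, qpoch (q ^ 4) (q ^ 4) l <> 0) by (intros; nonzero).
  unfold bshiftG, bshiftF, bshiftR.
  replace (bshiftT q 0 1 (q ^ 3) (q ^ 4) n n)
    with (q ^ (4 * n ^ 2) * qpoch q (q ^ 2) (2 * n) ^ 2
          / (qpoch (q ^ 4) (q ^ 4) n ^ 2 * qpoch (q ^ 4) (q ^ 4) (2 * n))).
  2:{ unfold bshiftT. replace (2 * n)%nat with (n + n)%nat by lia.
      replace (q * (q * q ^ 3 * 0)) with (RtoC 0) by ring.
      replace (q * q ^ 3 * 0) with (RtoC 0) by ring.
      replace (q ^ 3 * 0) with (RtoC 0) by ring.
      rewrite !qpoch_0, qpoch_double.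
      replace (q ^ 3 * 1) with (q ^ 3) by ring.
      replace (qpoch q (q ^ 4) n ^ 2 * hpoch ((q ^ 4) ^ n) q (q ^ 4) n
               * hpoch 0 1 (q ^ 4) n * (q ^ 3) ^ n)
        with (qpoch q (q ^ 4) n ^ 2
              * (hpoch ((q ^ 4) ^ n) q (q ^ 4) n * q ^ n)
              * (hpoch 0 1 (q ^ 4) n * (q ^ 2) ^ n))
        by (rewrite !(Cpow_pow_comm q 3), !(Cpow_pow_comm q 2); ring).
      rewrite hpoch_diagonal, hpoch_0_1.
      replace (4 * n ^ 2)%nat with (2 * n ^ 2 + 2 * n ^ 2)%nat by lia.
      rewrite Cpow_add_r.
      replace (q ^ (2 * n ^ 2) * q ^ (2 * n ^ 2))
        with ((- (1)) ^ n * (- (1)) ^ n * (q ^ (2 * n ^ 2) * q ^ (2 * n ^ 2)))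
        by (rewrite Cpow_m1_sqr; ring).
      field. auto. }
  generalize (q ^ (4 * n ^ 2) * qpoch q (q ^ 2) (2 * n) ^ 2
          / (qpoch (q ^ 4) (q ^ 4) n ^ 2 * qpoch (q ^ 4) (q ^ 4) (2 * n))).
  intros T. unfold qnum. revert D1.
  replace (S (8 * n + 3)) with (8 * n + 4)%nat by lia.
  rewrite !Cpow_affine, !(Cpow_pow_comm q 4).
  generalize (q ^ n). intros A D1.
  field. repeat split; auto.
  all: intro Z; apply D1; rewrite <- Z; ring.
Qed.

(** * The three sums *)

Theorem theorem1 (q : C) (hq : (Cmod q < 1)%R) :
  @is_series C_AbsRing C_NormedModule
    (fun n : nat =>
      (- (1)) ^ n * q ^ (2 * n ^ 2)
        * qpoch (q ^ 2) (q ^ 4) n ^ 2 * qpoch q (q ^ 2) (2 * n)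
      / (qpoch (q ^ 4) (q ^ 4) n ^ 2 * qpoch (q ^ 4) (q ^ 4) (2 * n))
      * (qnum q (8 * n + 1)
         + qnum q (4 * n + 1) * (q ^ (4 * n + 1) / (1 + q ^ (4 * n + 2)))))
    ((1 + q) * qpoch_inf (q ^ 2) (q ^ 4) * qpoch_inf (q ^ 6) (q ^ 4)
      / qpoch_inf (q ^ 4) (q ^ 4) ^ 2)
  /\
  @is_series C_AbsRing C_NormedModule
    (fun n : nat =>
      (- (1)) ^ n * q ^ (2 * n ^ 2)
        * qpoch (q ^ 2) (q ^ 4) n * qpoch (q ^ 2) (q ^ 4) (2 * n)
        * qpoch q (q ^ 2) (3 * n)
      / (qpoch (q ^ 4) (q ^ 4) n ^ 2 * qpoch (q ^ 4) (q ^ 4) (3 * n)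
         * qpoch q (q ^ 2) n)
      * (qnum q (10 * n + 1)
         + q ^ (6 * n + 1) * qnum q (4 * n + 2) * qnum q (6 * n + 1)
           / qnum q (12 * n + 4)
         + q ^ (6 * n + 3) * qnum q (6 * n + 1) * qnum q (6 * n + 3)
           * qnum q (8 * n + 2) * (1 + q ^ (2 * n + 1))
           / (qnum q (12 * n + 4) * qnum q (12 * n + 8))))
    ((1 + q) * qpoch_inf (q ^ 2) (q ^ 4) * qpoch_inf (q ^ 6) (q ^ 4)
      / qpoch_inf (q ^ 4) (q ^ 4) ^ 2)
  /\
  @is_series C_AbsRing C_NormedModule
    (fun n : nat =>
      q ^ (4 * n ^ 2) * qpoch q (q ^ 2) (2 * n) ^ 2
      / (qpoch (q ^ 4) (q ^ 4) n ^ 2 * qpoch (q ^ 4) (q ^ 4) (2 * n))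
      * (qnum q (8 * n + 1)
         - q ^ (8 * n + 3) * (qnum q (4 * n + 1) ^ 2 / qnum q (8 * n + 4))))
    (qpoch_inf (q ^ 3) (q ^ 4) * qpoch_inf (q ^ 5) (q ^ 4)
      / qpoch_inf (q ^ 4) (q ^ 4) ^ 2).
Proof.
  assert (H2 := Cmod_pow_lt_1 q 1 hq). assert (H3 := Cmod_pow_lt_1 q 2 hq).
  assert (H4 := Cmod_pow_lt_1 q 3 hq).
  assert (D0 := Cone_minus_neq_0 _ hq).
  assert (I4 := qpoch_inf_neq_0 (q ^ 4) (q ^ 4) H4 H4).
  assert (E1 : (Cmod 1 <= 1)%R) by (rewrite Cmod_1; lra).
  assert (E0 : (Cmod 0 <= 1)%R) by (rewrite Cmod_0; lra).
  (* The choice x = 1, y = q^2, s = q gives d = q^2 and p = q^4; the products of q and q^3 in base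
     q^4 cancel from the 6phi5 value. *)
  assert (A : @is_series C_AbsRing C_NormedModule (fun n => quadG q n O + quadF q n O)
                (qpoch_inf (q ^ 2) (q ^ 4) ^ 2 / qpoch_inf (q ^ 4) (q ^ 4) ^ 2)).
  { eapply is_series_ext; [intros n; apply (quad_bshift_diagonal q n hq)|].
    replace (qpoch_inf (q ^ 2) (q ^ 4) ^ 2 / qpoch_inf (q ^ 4) (q ^ 4) ^ 2)
      with (qpoch_inf q (q ^ 4) * qpoch_inf (q * q ^ 2) (q ^ 4)
            * qpoch_inf (q * q * 1) (q ^ 4) ^ 2
            / (qpoch_inf (q ^ 4) (q ^ 4) ^ 2 * qpoch_inf (q * (q * q * 1)) (q ^ 4)
               * qpoch_inf (q * 1) (q ^ 4))).
    - apply bshift_diagonal_series; [ring | lra | lra | exact E1 | lra].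
    - replace (q * (q * q * 1)) with (q ^ 3) by ring.
      replace (q * q ^ 2) with (q ^ 3) by ring.
      replace (q * q * 1) with (q ^ 2) by ring.
      replace (q * 1) with q by ring.
      field. repeat split; auto using qpoch_inf_neq_0. }
  (* Splitting 1 - q^2 off one product of q^2 leaves the product of q^6, and (1 - q^2)/(1 - q) = 1 +
     q. *)
  assert (EA : (1 + q) * qpoch_inf (q ^ 2) (q ^ 4) * qpoch_inf (q ^ 6) (q ^ 4)
      / qpoch_inf (q ^ 4) (q ^ 4) ^ 2
    = / (1 - q) * (qpoch_inf (q ^ 2) (q ^ 4) ^ 2 / qpoch_inf (q ^ 4) (q ^ 4) ^ 2)).
  { rewrite (qpoch_inf_shift (q ^ 2) (q ^ 4) H4).
    replace (q ^ 2 * q ^ 4) with (q ^ 6) by ring.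
    field; auto. }
  (* For x = 0 every infinite product containing x equals 1. *)
  assert (B : @is_series C_AbsRing C_NormedModule
     (fun n => bshiftG q 0 1 (q ^ 3) (q ^ 4) n n
               + bshiftF q 0 1 (q ^ 3) (q ^ 4) (S n) n)
     (qpoch_inf q (q ^ 4) * qpoch_inf (q ^ 3) (q ^ 4)
      / qpoch_inf (q ^ 4) (q ^ 4) ^ 2)).
  { replace (qpoch_inf q (q ^ 4) * qpoch_inf (q ^ 3) (q ^ 4)
             / qpoch_inf (q ^ 4) (q ^ 4) ^ 2)
      with (qpoch_inf q (q ^ 4) * qpoch_inf (q ^ 3 * 1) (q ^ 4)
            * qpoch_inf (q * q ^ 3 * 0) (q ^ 4) ^ 2
            / (qpoch_inf (q ^ 4) (q ^ 4) ^ 2 * qpoch_inf (q * (q * q ^ 3 * 0)) (q ^ 4)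
               * qpoch_inf (q ^ 3 * 0) (q ^ 4))).
    - apply bshift_diagonal_series; [ring | lra | lra | exact E0 | exact E1].
    - replace (q * (q * q ^ 3 * 0)) with (RtoC 0) by ring.
      replace (q * q ^ 3 * 0) with (RtoC 0) by ring.
      replace (q ^ 3 * 0) with (RtoC 0) by ring.
      replace (q ^ 3 * 1) with (q ^ 3) by ring.
      rewrite qpoch_inf_0. field; auto. }
  split; [|split].
  - rewrite EA.
    eapply is_series_ext; [intros n; symmetry; apply (sum1_term q n hq)|].
    exact (@is_series_scal C_AbsRing C_NormedModule (/ (1 - q)) _ _ A).
  - rewrite EA.
    eapply is_series_ext; [intros n; symmetry; apply (sum2_term q n hq)|].
    exact (@is_series_scal C_AbsRing C_NormedModule (/ (1 - q)) _ _
             (quad_double_diagonal_series q _ hq A)).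
  - replace (qpoch_inf (q ^ 3) (q ^ 4) * qpoch_inf (q ^ 5) (q ^ 4)
             / qpoch_inf (q ^ 4) (q ^ 4) ^ 2)
      with (/ (1 - q) * (qpoch_inf q (q ^ 4) * qpoch_inf (q ^ 3) (q ^ 4)
            / qpoch_inf (q ^ 4) (q ^ 4) ^ 2)).
    + eapply is_series_ext; [intros n; symmetry; apply (sum3_term q n hq)|].
      exact (@is_series_scal C_AbsRing C_NormedModule (/ (1 - q)) _ _ B).
    + rewrite (qpoch_inf_shift q (q ^ 4) H4).
      replace (q * q ^ 4) with (q ^ 5) by ring.
      field; auto.
Qed.
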